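(* For any positive integer $m$, $$\sum_{n=0}^{\infty}\frac{(-1)^m-1+\sum_{k=0}^{m-1}(-1)^k L_{2(m-k)(2m+1)^n}}{F_{(2m+1)^{n+1}}} = 1.$$
   Context: $F_n$ and $L_n$ denote the $n$-th Fibonacci and Lucas numbers: $F_n = \frac{\alpha^n-\beta^n}{\sqrt5}$ and $L_n=\alpha^n+\beta^n$, where $\alpha=\frac{1+\sqrt5}{2}$ and $\beta=\frac{1-\sqrt5}{2}$ (so $F_0=0$, $F_1=1$, $L_0=2$, $L_1=1$). *)

(* Defs.v *)
From Stdlib Require Import Reals Lra Lia.
From Coquelicot Require Import Coquelicot.
Open Scope R_scope.

Definition alpha : R := (1 + sqrt 5) / 2.
Definition beta : R := (1 - sqrt 5) / 2.

Definition fib (n : nat) : R := (alpha ^ n - beta ^ n) / sqrt 5.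
Definition lucas (n : nat) : R := alpha ^ n + beta ^ n.

Lemma sqrt5_neq0 : sqrt 5 <> 0.
Proof. apply Rgt_not_eq, sqrt_lt_R0; lra. Qed.

Lemma alpha_sqr : alpha * alpha = alpha + 1.
Proof.
  assert (H : sqrt 5 * sqrt 5 = 5) by (apply sqrt_sqrt; lra).
  unfold alpha; nra.
Qed.

Lemma beta_sqr : beta * beta = beta + 1.
Proof.
  assert (H : sqrt 5 * sqrt 5 = 5) by (apply sqrt_sqrt; lra).
  unfold beta; nra.
Qed.

Lemma fib_0 : fib 0 = 0.
Proof. unfold fib; simpl; field; apply sqrt5_neq0. Qed.

Lemma fib_1 : fib 1 = 1.
Proof. unfold fib, alpha, beta; simpl; field; apply sqrt5_neq0. Qed.

Lemma fib_SS (n : nat) : fib (S (S n)) = fib (S n) + fib n.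
Proof.
  unfold fib; simpl.
  rewrite <- !Rmult_assoc, alpha_sqr, beta_sqr; field; apply sqrt5_neq0.
Qed.

Lemma lucas_0 : lucas 0 = 2.
Proof. unfold lucas; simpl; ring. Qed.

Lemma lucas_1 : lucas 1 = 1.
Proof. unfold lucas, alpha, beta; simpl; field. Qed.

Lemma lucas_SS (n : nat) : lucas (S (S n)) = lucas (S n) + lucas n.
Proof.
  unfold lucas; simpl.
  rewrite <- !Rmult_assoc, alpha_sqr, beta_sqr; ring.
Qed.

(* Main.v *)
Require Import Defs.
From Stdlib Require Import Reals Lra Lia.
From Coquelicot Require Import Coquelicot.
Open Scope R_scope.

(** Put [N = (2m+1)^n], [a = alpha^N], [b = beta^N]; as [N] is odd, [a b = -1].
    Grouping the terms of [(a^(2m+1) - b^(2m+1)) / (a - b) = sum_j a^(2m-j) b^j]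
    symmetrically about the middle one shows that the numerator is
    [F_((2m+1)N) / F_N - 1], so the [n]-th term is [1 / F_N - 1 / F_((2m+1)N)]
    and the series telescopes to [1 / F_1 = 1]. *)

Lemma alpha_mul_beta : alpha * beta = -1.
Proof.
  assert (H : sqrt 5 * sqrt 5 = 5) by (apply sqrt_sqrt; lra).
  unfold alpha, beta; nra.
Qed.

Lemma pow_m1_odd (N : nat) : Nat.Odd N -> (-1) ^ N = -1.
Proof.
  intros [p ->].
  rewrite Nat.add_1_r; apply pow_1_odd.
Qed.

(** With [D_q = a^q - b^q], the hypothesis [a * b = -1] gives [D_(q+2) = (a - b) (a^(q+1) + b^(q+1))
    - D_q], which drives the induction. *)
Lemma sub_pow_odd (a b : R) (p : nat) : a * b = -1 ->
  a ^ (2 * S p + 1) - b ^ (2 * S p + 1) =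
  (a - b) * ((-1) ^ S p +
    sum_n (fun k => (-1) ^ k * (a ^ (2 * (S p - k)) + b ^ (2 * (S p - k)))) p).
Proof.
  intros Hab; induction p as [|p IH].
  - rewrite sum_O; simpl.
    transitivity (a ^ 3 - b ^ 3 - (1 + a * b) * (a - b)); [rewrite Hab|]; ring.
  - rewrite sum_n_Reals, decomp_sum by lia.
    rewrite sum_n_Reals in IH; cbn [Nat.pred].
    (* Past its first term, the sum for [S p] is minus the sum for [p]. *)
    rewrite (sum_eq _ (fun k => (-1) ^ k *
      (a ^ (2 * (S p - k)) + b ^ (2 * (S p - k))) * -1) p)
      by (intros i _; cbn [Nat.sub pow]; ring).
    rewrite <- scal_sum.
    set (s := sum_f_R0 _ p) in *.
    replace (2 * (S (S p) - 0))%nat with (S (2 * S p + 1)) by lia.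
    replace (2 * S (S p) + 1)%nat with (S (S (2 * S p + 1))) by lia.
    set (q := (2 * S p + 1)%nat) in *.
    cbn [pow] in *.
    (* The summand with factor [1 + a * b] is zero; adding it makes the equation a polynomial
       identity. *)
    transitivity ((a - b) * (a * a ^ q + b * b ^ q) - (a ^ q - b ^ q)
                  + (1 + a * b) * (a ^ q - b ^ q)); [ring|].
    rewrite Hab, IH at 1; ring_simplify; nra.
Qed.

(** By Binet, this is [sub_pow_odd] at [alpha ^ N] and [beta ^ N], whose product is
    [(-1) ^ N = -1]. *)
Lemma fib_mul_odd (p N : nat) : Nat.Odd N ->
  fib ((2 * S p + 1) * N) =
  fib N * ((-1) ^ S p +
    sum_n (fun k => (-1) ^ k * lucas (2 * (S p - k) * N)) p).
Proof.
  intros HN.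
  assert (Hab : alpha ^ N * beta ^ N = -1).
  { rewrite <- Rpow_mult_distr, alpha_mul_beta; apply pow_m1_odd, HN. }
  unfold fib, lucas.
  rewrite (Nat.mul_comm _ N), !pow_mult, (sub_pow_odd _ _ p Hab).
  rewrite (sum_n_ext (fun k => (-1) ^ k *
    ((alpha ^ N) ^ (2 * (S p - k)) + (beta ^ N) ^ (2 * (S p - k))))
    (fun k => (-1) ^ k *
      (alpha ^ (2 * (S p - k) * N) + beta ^ (2 * (S p - k) * N)))).
  2:{ intros k; rewrite (Nat.mul_comm _ N), !(pow_mult _ N); reflexivity. }
  field; apply sqrt5_neq0.
Qed.

(** The bound by 1 makes each step of the recurrence add at least 1, which yields the linear
    bound. *)
Lemma fib_ge_pred (n : nat) : 1 <= fib (S n) /\ INR n <= fib (S n).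
Proof.
  enough (H : (1 <= fib (S n) /\ INR n <= fib (S n)) /\
              1 <= fib (S (S n)) /\ INR (S n) <= fib (S (S n))) by apply H.
  induction n as [|n [H1 H2]].
  - rewrite fib_SS, fib_1, fib_0; simpl; lra.
  - split; [exact H2|].
    rewrite (fib_SS (S n)), !S_INR in *; lra.
Qed.

Lemma fib_pos (n : nat) : (0 < n)%nat -> 0 < fib n.
Proof.
  destruct n as [|n]; [lia|]; intros _.
  destruct (fib_ge_pred n); lra.
Qed.

Lemma is_lim_seq_inv_fib_pow (M : nat) : (1 < M)%nat ->
  is_lim_seq (fun n => / fib (M ^ n)) 0.
Proof.
  intros HM.
  replace (Finite 0) with (Rbar_inv p_infty) by reflexivity.
  apply is_lim_seq_inv; [|discriminate].
  apply (is_lim_seq_le_p_loc INR); [|apply is_lim_seq_INR].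
  exists 0%nat; intros n _.
  (* As [M ^ n > n], writing [M ^ n = S q] gives [n <= q <= fib (S q)]. *)
  pose proof (Nat.pow_gt_lin_r M n HM).
  destruct (M ^ n)%nat as [|q]; [lia|].
  apply Rle_trans with (INR q); [apply le_INR; lia | apply fib_ge_pred].
Qed.

Lemma is_series_telescope (u : nat -> R) (l : R) :
  is_lim_seq u l -> is_series (fun n => u n - u (S n)) (u 0%nat - l).
Proof.
  intros Hu.
  change (is_lim_seq (sum_n (fun n => u n - u (S n))) (u 0%nat - l)).
  apply (is_lim_seq_ext (fun n => u 0%nat - u (S n))).
  - intros n; induction n as [|n IH].
    + now rewrite sum_O.
    + rewrite sum_Sn, <- IH; unfold plus; simpl; ring.
  - apply is_lim_seq_minus'; [apply is_lim_seq_const|].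
    exact (proj1 (is_lim_seq_incr_1 u l) Hu).
Qed.

(* In the inner sum, m - k and m - 1 are on nat, never truncated since
   0 <= k <= m - 1 and m > 0. *)
Theorem theorem3 (m : nat) (hm : (0 < m)%nat) :
  is_series
    (fun n : nat =>
       ((-1) ^ m - 1
        + sum_n (fun k : nat =>
                   (-1) ^ k * lucas (2 * (m - k) * (2 * m + 1) ^ n)) (m - 1))
       / fib ((2 * m + 1) ^ (n + 1)))
    1.
Proof.
  destruct m as [|p]; [lia|].
  set (M := (2 * S p + 1)%nat).
  assert (HM : (1 < M)%nat) by (unfold M; lia).
  replace 1 with (/ fib (M ^ 0) - 0) at 1.
  2:{ rewrite Nat.pow_0_r, fib_1; field. }
  eapply is_series_ext;
    [|apply (is_series_telescope (fun n => / fib (M ^ n)));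
      apply is_lim_seq_inv_fib_pow, HM].
  (* The goal is an equation in the carrier of a normed module; [field] needs it in [R]. *)
  intros n; cbv beta; apply (@eq_trans R _ _ _ eq_refl).
  assert (Hodd : Nat.Odd (M ^ n)).
  { apply Nat.odd_spec; destruct n as [|n]; [reflexivity|].
    rewrite Nat.odd_pow by lia.
    apply Nat.odd_spec; exists (S p); reflexivity. }
  assert (HN : 0 < fib (M ^ n)) by (apply fib_pos, Nat.neq_0_lt_0, Nat.pow_nonzero; lia).
  assert (HS : 0 < fib (M ^ S n)) by (apply fib_pos, Nat.neq_0_lt_0, Nat.pow_nonzero; lia).
  replace (S p - 1)%nat with p by lia.
  rewrite Nat.add_1_r.
  pose proof (fib_mul_odd p (M ^ n) Hodd) as E.
  (* [M ^ S n] is convertible to [M * M ^ n]. *)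
  change (fib (M ^ S n) = fib (M ^ n) * ((-1) ^ S p +
    sum_n (fun k => (-1) ^ k * lucas (2 * (S p - k) * M ^ n)) p)) in E.
  set (s := sum_n _ p) in *.
  replace ((-1) ^ S p - 1 + s) with (fib (M ^ S n) / fib (M ^ n) - 1).
  - field; lra.
  - rewrite E; field; lra.
Qed.
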